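(* Let $n\ge 2$ and $s\ge 1$ be integers. If $n$ is even, then \[ \frac{n}{2}\left\lfloor\frac{s}{2}\right\rfloor\le f_{\mathrm{id,bin}}(n,s)\le\frac{sn}{4}. \] If $n$ is odd, then \[ \frac{n+1}{2}\left\lfloor\frac{s(n-1)}{2n}\right\rfloor\le f_{\mathrm{id,bin}}(n,s)\le\frac{s(n-1)(n+1)}{4n}. \]
   Context: Let $N=\{1,\dots,n\}$ be a set of $n\ge 2$ agents and $M$ a finite set of indivisible goods. Each agent $i$ has an additive utility function $u_i:2^M\to\mathbb{R}_{\ge 0}$, i.e., $u_i(M')=\sum_{g\in M'}u_i(\{g\})$. An instance consists of $N$, $M$ and $(u_i)_{i\in N}$. Utilities are identical if $u_i=u_j$ for all $i,j\in N$, and binary if $u_i(\{g\})\in\{0,1\}$ for all $i\in N$, $g\in M$. An allocation $\mathcal{A}=(A_1,\dots,A_n)$ is an ordered partition of $M$ into $n$ (possibly empty) bundles, $A_i$ going to agent $i$; it is $s$-balanced if $|A_i|=s$ for all $i\in N$. Agent $i$ is EF1 towards agent $j$ in $\mathcal{A}$ if $A_j=\varnothing$ or there exists $g\in A_j$ with $u_i(A_i)\ge u_i(A_j\setminus\{g\})$. $\mathcal{A}$ is EF1 if every agent is EF1 towards every other agent. An exchange transforms an allocation $\mathcal{A}$ into an allocation $\mathcal{B}$ where, for some distinct $i,j\in N$, $g\in A_i$, $g'\in A_j$, we have $B_i=(A_i\cup\{g'\})\setminus\{g\}$, $B_j=(A_j\cup\{g\})\setminus\{g'\}$, and $B_k=A_k$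 for $k\ne i,j$. $f_{\mathrm{id,bin}}(n,s)$ denotes the smallest integer such that for every instance with $n$ agents with identical binary utilities and $ns$ goods and every $s$-balanced allocation $\mathcal{A}$ in the instance, some EF1 allocation can be reached from $\mathcal{A}$ using at most $f_{\mathrm{id,bin}}(n,s)$ exchanges. *)

(* Defs.v *)
From mathcomp Require Import all_boot all_order all_algebra.
From mathcomp Require Import reals.

Set Implicit Arguments.
Unset Strict Implicit.
Unset Printing Implicit Defensive.

Import Order.TTheory GRing.Theory Num.Theory.
Local Open Scope ring_scope.

Record instance (R : realType) (n : nat) := Instance {
  goods : finType;
  util : 'I_n -> {set goods} -> R;
  util_ge0 : forall i S, 0 <= util i S;
  util_additive : forall i S, util i S = \sum_(g in S) util i [set g] }.

Arguments goods {R n} _.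
Arguments util {R n} _ _ _.

Definition identical_utilities (R : realType) (n : nat) (I : instance R n) :=
  forall i j : 'I_n, util I i =1 util I j.

Definition binary_utilities (R : realType) (n : nat) (I : instance R n) :=
  forall (i : 'I_n) (g : goods I), util I i [set g] = 0 \/ util I i [set g] = 1.

Notation bundles n M := {ffun 'I_n -> {set M}}.

(* finset's [partition] is not used here because bundles may be empty. *)
Definition allocation (n : nat) (M : finType) (A : bundles n M) : bool :=
  [forall i, forall j, (i != j) ==> [disjoint A i & A j]]
  && (\bigcup_i A i == [set: M]).

Definition balanced (s n : nat) (M : finType) (A : bundles n M) : bool :=
  [forall i, #|A i| == s].

Definition EF1_towards (R : realType) (n : nat) (I : instance R n)
    (A : bundles n (goods I)) (i j : 'I_n) : bool :=
  (A j == set0) || [exists g in A j, util I i (A j :\ g) <= util I i (A i)].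

Definition EF1 (R : realType) (n : nat) (I : instance R n)
    (A : bundles n (goods I)) : bool :=
  [forall i, forall j, (i != j) ==> EF1_towards A i j].

Definition exchange (n : nat) (M : finType) : rel (bundles n M) := fun A B =>
  [exists i, exists j, exists g in A i, exists g' in A j,
    [&& i != j,
        B i == (A i :|: [set g']) :\ g,
        B j == (A j :|: [set g]) :\ g'
      & [forall k, (k != i) && (k != j) ==> (B k == A k)]]].

Definition reachable_within (n : nat) (M : finType) (k : nat)
    (A B : bundles n M) : Prop :=
  exists p : seq (bundles n M),
    [/\ (size p <= k)%N, path (@exchange n M) A p & last A p = B].

Definition exchanges_suffice (R : realType) (n s k : nat) : Prop :=
  forall I : instance R n,
    identical_utilities I -> binary_utilities I -> #|goods I| = (n * s)%N ->
  forall A : bundles n (goods I), allocation A -> balanced s A ->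
  exists B : bundles n (goods I),
    [/\ allocation B, EF1 B & reachable_within k A B].

Definition is_f_id_bin (R : realType) (n s f : nat) : Prop :=
  exchanges_suffice R n s f
  /\ forall k : nat, exchanges_suffice R n s k -> (f <= k)%N.

(* Main.v *)
(** With identical binary utilities only the number c_i of valuable goods in
    each bundle matters: an allocation is EF1 iff the c_i differ pairwise by at
    most one, and an exchange moves at most one valuable good.

    Upper bound: let q and r be the quotient and remainder of the number of
    valuable goods by n. Choose targets q or q + 1 for the agents so that, with
    a the number of agents with c_i > q, the total surplus k over the targets
    satisfies k <= a (s - m) and k <= (n - a) m for a common threshold m. Then
    n k <= a (n - a) s, and k exchanges, each from an agent above its target to
    one below, reach the targets.

    Lower bound: give uphalf n agents no valuable good and the others only
    valuable goods. In an EF1 allocation each of the former holds at least the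
    floor of the average, while each exchange adds at most one good to the union
    of their bundles. *)
Require Import Defs.
From mathcomp Require Import all_boot all_order all_algebra.
From mathcomp Require Import perm reals boolp zify.
Import Order.TTheory GRing.Theory Num.Theory.

(** * Goods of a set [V] in bundles, and the effect of exchanges *)

Section Counts.
Context {n : nat} {M : finType}.
Implicit Types (A B : {ffun 'I_n -> {set M}}) (V : {set M}) (P : {set 'I_n}).

Lemma allocationP A :
  reflect ((forall i j x, x \in A i -> x \in A j -> i = j) /\
           (forall x, exists i, x \in A i))
          (allocation A).
Proof.
apply: (iffP andP) => [[/forallP disjA /eqP covA]|[injA covA]]; split.
- move=> i j x Ai Aj; apply/eqP/negP=> /negP nij.
  move/forallP: (disjA i) => /(_ j); rewrite nij /= => /disjoint_setI0/setP/(_ x).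
  by rewrite !inE Ai Aj.
- by move=> x; have: x \in [set: M] by []; rewrite -covA => /bigcupP[i]; exists i.
- apply/forallP=> i; apply/forallP=> j; apply/implyP=> nij.
  rewrite -setI_eq0; apply/eqP/setP=> x; rewrite !inE.
  by apply/negbTE/negP=> /andP[Ai Aj]; case/eqP: nij; apply: injA Ai Aj.
- apply/eqP/setP=> x; rewrite inE; apply/bigcupP.
  by have [i] := covA x; exists i.
Qed.

Lemma sum_card_bundles A V P : allocation A ->
  \sum_(i in P) #|A i :&: V| = #|(\bigcup_(i in P) A i) :&: V|.
Proof.
case/allocationP=> injA _.
rewrite big_mkcond /=.
pose F i := if i \in P then A i :&: V else set0.
have disjF i j : i != j -> [disjoint F i & F j].
  move=> nij; rewrite -setI_eq0; apply/eqP/setP=> x; rewrite !inE /F.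
  apply/negbTE/negP=> /andP[].
  case: ifP => _; case: ifP => _; rewrite !inE //.
  move=> /andP[Ai _] /andP[Aj _].
  by case/eqP: nij; apply: injA Ai Aj.
have := partition_disjoint_bigcup addn (fun=> 1) disjF.
rewrite sum1_card => eqF.
rewrite (_ : _ :&: _ = \bigcup_i F i); last first.
  rewrite big_distrl big_mkcond /=; apply: eq_bigr => i _; rewrite /F.
  by case: ifP.
rewrite eqF; apply: eq_bigr => i _.
by rewrite sum1_card /F; case: ifP => // _; rewrite cards0.
Qed.

Lemma sum_card_allocation A V : allocation A -> \sum_i #|A i :&: V| = #|V|.
Proof.
move=> allocA; have := sum_card_bundles A V setT allocA.
rewrite !(eq_bigl _ _ (in_setT (T := 'I_n))) => ->.
by case/andP: allocA => _ /eqP->; rewrite setTI.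
Qed.

Lemma exchange_bigcup A B P : exchange A B ->
  exists x, \bigcup_(i in P) B i \subset x |: \bigcup_(i in P) A i.
Proof.
case/existsP=> i /existsP[j] /existsP[g] /andP[Aig] /existsP[g'] /andP[Ajg'].
case/and4P=> nij /eqP Bi /eqP Bj /forallP Bk.
(* A good can enter the union only when exactly one of [i] and [j] lies in [P], and it is then the
   good which that agent receives. *)
exists (if i \in P then g' else g); apply/bigcupsP=> k Pk; apply/subsetP=> x.
have inA l y : l \in P -> y \in A l -> y \in \bigcup_(i in P) A i.
  by move=> Pl Aly; apply/bigcupP; exists l.
case: (eqVneq k i) Pk => [-> Pi|nki Pk].
  rewrite Bi Pi !inE => /andP[_ /orP[Aix|->//]].
  by rewrite (inA i) ?orbT.
case: (eqVneq k j) Pk => [-> Pj|nkj Pk].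
  rewrite Bj !inE => /andP[_ /orP[Ajx|/eqP->]].
    by rewrite (inA j) ?orbT.
  by case: ifP => [Pi|]; rewrite ?eqxx // (inA i) ?orbT.
move: (Bk k); rewrite nki nkj => /eqP-> Akx.
by rewrite !inE (inA k) ?orbT.
Qed.

Lemma reachable_bigcup A B V P k : reachable_within k A B ->
  #|(\bigcup_(i in P) B i) :&: V| <= #|(\bigcup_(i in P) A i) :&: V| + k.
Proof.
case=> p [+ + <-]; elim: p A k => [|C p IHp] A k /=; first by rewrite leq_addr.
case: k => // k lepk /andP[/(exchange_bigcup _ _ P)[x sCA] pathC].
apply: leq_trans (IHp _ _ lepk pathC) _; rewrite addnS -addSn leq_add2r.
have := subset_leq_card (setSI V sCA).
move/leq_trans; apply; rewrite setIUl.
apply: leq_trans (leq_card_setU _ _) _; rewrite -add1n leq_add2r.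
by apply: leq_trans (subset_leq_card (subsetIl _ _)) _; rewrite cards1.
Qed.

(** Agent [j] holds [s] goods but fewer than [s] from [V], so it has one outside [V] to trade for a
    good of [i] in [V]. *)
Lemma exchange_transfer A V s i j :
    allocation A -> balanced s A -> i != j ->
    0 < #|A i :&: V| -> #|A j :&: V| < s ->
  exists B, [/\ exchange A B, allocation B, balanced s B &
    [/\ #|A i :&: V| = #|B i :&: V|.+1, #|B j :&: V| = #|A j :&: V|.+1 &
        forall k, k != i -> k != j -> B k = A k]].
Proof.
move=> /allocationP[injA covA] /forallP balA nij /card_gt0P[g].
rewrite inE => /andP[Aig Vg] ltj.
have [g' Ajg' nVg'] : exists2 g', g' \in A j & g' \notin V.
  apply/subsetPn; apply: contraL ltj => /setIidPl->.
  by rewrite (eqP (balA j)) ltnn.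
have nAjg : g \notin A j by apply: contra nij => /(injA i j g Aig)->.
have nAig' : g' \notin A i by apply: contra nij => /(injA i j g')->.
have ngg' : g != g' by apply: contraNneq nVg' => <-.
(* Written as a relabelling of the goods, the exchange visibly preserves
   allocations and bundle sizes. *)
pose B : {ffun 'I_n -> {set M}} := [ffun k => tperm g g' @^-1: A k].
have Bi : B i = (A i :|: [set g']) :\ g.
  apply/setP=> x; rewrite ffunE !inE.
  case: tpermP => [->|->|/eqP-> /eqP/negbTE->]; rewrite ?eqxx ?(negbTE nAig') //.
    by rewrite Aig orbT eq_sym ngg'.
  by rewrite orbF.
have Bj : B j = (A j :|: [set g]) :\ g'.
  apply/setP=> x; rewrite ffunE !inE.
  case: tpermP => [->|->|/eqP/negbTE-> /eqP->]; rewrite ?eqxx ?(negbTE nAjg) //.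
    by rewrite Ajg' orbT ngg'.
  by rewrite orbF.
have Bk k : k != i -> k != j -> B k = A k.
  move=> nki nkj; apply/setP=> x; rewrite ffunE inE.
  have nAkg : (g \in A k) = false.
    by apply: contraNF nki => /(injA i k g Aig)->.
  have nAkg' : (g' \in A k) = false.
    by apply: contraNF nkj => /(injA j k g' Ajg')->.
  by case: tpermP => // ->; rewrite nAkg nAkg'.
exists B; split.
- apply/existsP; exists i; apply/existsP; exists j.
  apply/existsP; exists g; rewrite Aig /=; apply/existsP; exists g'.
  rewrite Ajg' nij Bi Bj !eqxx /=; apply/forallP=> k.
  by apply/implyP=> /andP[nki nkj]; rewrite Bk.
- apply/allocationP; split=> [k l x|x]; first by rewrite !ffunE !inE; apply: injA.
  by have [k Akx] := covA (tperm g g' x); exists k; rewrite ffunE inE.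
- by apply/forallP=> k; rewrite ffunE card_preimset ?balA //; apply: perm_inj.
split=> //.
- rewrite (cardsD1 g (A i :&: V)) inE Aig Vg add1n; congr _.+1.
  congr #|pred_of_set _|; apply/setP=> x; rewrite Bi !inE.
  by case: (eqVneq x g') => [->|]; rewrite ?(negbTE nVg') ?andbF //= orbF andbA.
- rewrite (_ : B j :&: V = g |: (A j :&: V)) ?cardsU1 ?inE ?(negbTE nAjg) //.
  apply/setP=> x; rewrite Bj !inE.
  case: (eqVneq x g') => [->|] /=.
    by rewrite (negbTE nVg') andbF orbF eq_sym (negbTE ngg').
  by case: (eqVneq x g) => [->|] /=; rewrite ?Vg ?orbT ?orbF.
Qed.

(** While some agent exceeds its target, equal totals put another below its own, and a transfer
    between the two lowers the surplus by one. The bound [t i <= s] guarantees the receiver a good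
    outside [V] to hand over. *)
Lemma reach_target A V s (t : 'I_n -> nat) k :
    allocation A -> balanced s A -> (forall i, t i <= s) ->
    \sum_i t i = #|V| -> \sum_i (#|A i :&: V| - t i) <= k ->
  exists B, [/\ allocation B, reachable_within k A B &
                forall i, #|B i :&: V| = t i].
Proof.
move=> + + les sumt; elim: k A => [|k IHk] A allocA balA lek.
  exists A; split=> //; first by exists [::].
  (* Zero surplus leaves every count at most its target; equal totals then force equality. *)
  move: lek; rewrite leqn0 sum_nat_eq0 => /forallP le_t.
  have {}le_t i : #|A i :&: V| <= t i by have := le_t i; rewrite subn_eq0.
  have := leqif_sum (fun i (_ : true) => leqif_eq (le_t i)).
  rewrite sum_card_allocation // sumt => -[_].
  by rewrite eqxx => /esym/forallP eqt i; apply/eqP/(eqt i).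
have [/existsP[i lti]|nex] := boolP [exists i, t i < #|A i :&: V|]; last first.
  have [|B [allocB [p [lep pathp lastp]] ctB]] := IHk A allocA balA; last first.
    by exists B; split=> //; exists p; split=> //; apply: leqW.
  rewrite big1 // => i _; apply/eqP; rewrite subn_eq0 leqNgt.
  by apply: contra nex => lti; apply/existsP; exists i.
have [j ltj] : exists j, #|A j :&: V| < t j.
  apply/existsP; apply: contraTT isT => /existsPn get.
  have : \sum_i t i < \sum_i #|A i :&: V|.
    rewrite (bigD1 i) // [ltnRHS](bigD1 i) //= -addSn leq_add //.
    by apply: leq_sum => j _; rewrite leqNgt.
  by rewrite sum_card_allocation // sumt ltnn.
have nij : i != j by apply: contraTneq ltj => <-; rewrite -leqNgt ltnW.
have [||C [exAC allocC balC [Ci Cj Ck]]] :=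
  exchange_transfer A V s i j allocA balA nij.
- exact: leq_ltn_trans lti.
- exact: leq_trans ltj _.
have [|B [allocB [p [lep pathp lastp]] ctB]] := IHk C allocC balC; last first.
  by exists B; split=> //; exists (C :: p); split=> //=; rewrite exAC.
rewrite -ltnS; apply: leq_trans lek.
rewrite (bigD1 i) // [leqRHS](bigD1 i) //= -addSn leq_add //; first by lia.
apply: leq_sum => l nli; have [->|nlj] := eqVneq l j; last by rewrite Ck.
(* Agent [j] was below its target, so its truncated difference stays 0. *)
by rewrite Cj; lia.
Qed.

End Counts.

(** * Near-equal counts and their surplus *)

(* Both the surplus over [t], which lives on [H], and the equal deficit, which
   lives off [H], are bounded using the threshold [m]; combine the two bounds
   with weights [n - #|H|] and [#|H|]. *)
Lemma surplus_bound n s m (H : {set 'I_n}) (c t : 'I_n -> nat) :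
    (forall i, c i <= s) -> \sum_i c i = \sum_i t i ->
    (forall i, i \in H -> m <= t i <= c i) ->
    (forall i, i \notin H -> c i <= t i <= m) ->
  n * \sum_i (c i - t i) <= #|H| * (n - #|H|) * s.
Proof.
move=> les sumct inH outH.
have cardH : #|H| + #|~: H| = n by rewrite cardsC card_ord.
have surplus : \sum_i (c i - t i) = \sum_i (t i - c i).
  apply/eqP; rewrite -(eqn_add2r (\sum_i t i)) -{2}sumct -!big_split /=.
  by apply/eqP/eq_bigr=> i _; lia.
have surplusH : \sum_i (c i - t i) <= #|H| * (s - m).
  rewrite -sum_nat_const [leqRHS]big_mkcond; apply: leq_sum => i _ /=.
  have := les i; case: ifPn => [/inH|/outH]; lia.
have deficitH : \sum_i (t i - c i) <= #|~: H| * m.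
  rewrite -sum_nat_const [leqRHS]big_mkcond; apply: leq_sum => i _ /=.
  by rewrite inE; case: ifPn => [/outH|/negbNE/inH]; lia.
rewrite -surplus in deficitH.
have -> : n - #|H| = #|~: H| by lia.
rewrite -{1}cardH.
have [lems|ltsm] := leqP m s; last first.
  (* For [m > s] the truncated [s - m] is 0, so the surplus vanishes. *)
  by move: surplusH; rewrite (eqP (ltnW ltsm)) muln0 leqn0 => /eqP->; rewrite muln0.
rewrite -[in leqRHS](subnKC lems) mulnDl mulnDr leq_add //.
  by rewrite -mulnA leq_mul2l deficitH orbT.
by rewrite [#|H| * _]mulnC -mulnA leq_mul2l surplusH orbT.
Qed.

Lemma intermediate_set (T : finType) (U W : {set T}) r :
    U \subset W -> #|U| <= r <= #|W| ->
  exists S : {set T}, [/\ U \subset S, S \subset W & #|S| = r].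
Proof.
move=> sUW /andP[]; move Dd: (r - #|U|) => d.
elim: d U sUW Dd => [|d IHd] U sUW Dd leU leW.
  by exists U; split=> //; lia.
have /subsetPn[x Wx nUx] : ~~ (W \subset U).
  by apply: contraL leW => /subset_leq_card; lia.
have cardU : #|x |: U| = #|U|.+1 by rewrite cardsU1 nUx.
have [||||S [sUS sSW cardS]] := IHd (x |: U); try by rewrite cardU; lia.
- by rewrite subUset sub1set Wx.
- by [].
by exists S; split=> //; apply: subset_trans sUS; apply: subsetUr.
Qed.

(** With [o] the parity of [n], [h = n./2] and [d] the distance from [a] to the nearer of [h] and
    [h + o], the two sides differ by [d * (d + o)]. *)
Lemma mul_half_ge a n : a <= n -> a * (n - a) <= uphalf n * n./2.
Proof.
move=> lean; rewrite uphalf_half; have := odd_double_half n.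
move: n./2 (odd n : nat) (leq_b1 (odd n)) => h o o_le1 Dn.
have [leh|lth] := leqP a h.
  have [d Dh] : exists d, h = a + d by exists (h - a); lia.
  have -> : n - a = o + a + d.*2 by lia.
  by rewrite {}Dh; nia.
have [d Da] : exists d, a = h + o + d by exists (a - h - o); lia.
have -> : n - a = h - d by lia.
by rewrite {}Da; nia.
Qed.

Lemma balanced_target n s (c : 'I_n -> nat) : 0 < n -> (forall i, c i <= s) ->
  exists t : 'I_n -> nat,
    [/\ \sum_i t i = \sum_i c i, forall i, t i <= s,
        forall i j, t i <= (t j).+1 &
        n * \sum_i (c i - t i) <= uphalf n * n./2 * s].
Proof.
move=> n_gt0 les; set T := \sum_i c i; set q := T %/ n; set r := T %% n.
have leT : T <= n * s.
  by rewrite -[n in leqRHS]card_ord -sum_nat_const; apply: leq_sum.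
pose H : {set 'I_n} := [set i | q < c i].
pose t (S : {set 'I_n}) i := q + (i \in S).
have sumt (S : {set 'I_n}) : #|S| = r -> \sum_i t S i = T.
  move=> cardS; rewrite big_split /= sum_nat_const card_ord.
  by rewrite (eq_bigr (fun i => if i \in S then 1 else 0)) // -big_mkcond
             sum1_card cardS mulnC -divn_eq.
have tles (S : {set 'I_n}) i : #|S| = r -> t S i <= s.
  move=> cardS; have eT := divn_eq T n; rewrite -/q -/r in eT.
  rewrite /t; have ltin := ltn_ord i; case: (boolP (i \in S)) => [Si|_] /=.
    (* A nonempty [S] makes the remainder positive, so [q * n + r <= n * s] forces [q < s]. *)
    have : 0 < r by rewrite -cardS; apply/card_gt0P; exists i.
    nia.
  nia.
have bound (S : {set 'I_n}) m : #|S| = r ->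
    (forall i, i \in H -> m <= t S i <= c i) ->
    (forall i, i \notin H -> c i <= t S i <= m) ->
    n * \sum_i (c i - t S i) <= uphalf n * n./2 * s.
  move=> cardS inH outH.
  apply: leq_trans (surplus_bound n s m H c (t S) les _ inH outH) _.
    by rewrite sumt.
  rewrite leq_mul2r mul_half_ge ?orbT //.
  by rewrite -[n in leqRHS]card_ord max_card.
suff [S [cardS boundS]] : exists S : {set 'I_n}, #|S| = r /\
    n * \sum_i (c i - t S i) <= uphalf n * n./2 * s.
  exists (t S); split=> // [|i|i j]; first exact: sumt; first exact: tles.
  by rewrite /t; lia.
(* The [r] agents with target [q + 1] are chosen inside [H] if [H] is large
   enough, and otherwise include all of [H]. *)
have [leH|ltH] := leqP r #|H|.
  have [||S [_ sSH cardS]] := intermediate_set _ set0 H r; rewrite ?sub0set ?cards0 //.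
  (* Targets are exactly [q] outside [H] and at least [q] inside, so [q] is a threshold. *)
  exists S; split=> //; apply: (bound S q) => // i; rewrite /t.
    by rewrite inE; lia.
  by move=> nHi; rewrite (contraNF (subsetP sSH i) nHi); move: nHi; rewrite inE; lia.
have [||S [sHS _ cardS]] := intermediate_set _ H setT r; rewrite ?subsetT //.
  by rewrite cardsT card_ord (ltnW ltH) ltnW // ltn_mod.
(* All of [H] has target [q + 1], which no target exceeds, so the threshold is [q + 1]. *)
exists S; split=> //; apply: (bound S q.+1) => // i; rewrite /t.
  by move=> Hi; rewrite (subsetP sHS) //; move: Hi; rewrite inE; lia.
by rewrite inE; lia.
Qed.

(** One count below [m] would keep all others at most [m], hence the total below [n * m]. *)
Lemma EF1_floor n (M : finType) (B : {ffun 'I_n -> {set M}}) V m :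
    allocation B -> (forall i j, #|B j :&: V| <= #|B i :&: V|.+1) ->
    n * m <= #|V| ->
  forall i, m <= #|B i :&: V|.
Proof.
move=> allocB near leV i; rewrite leqNgt; apply/negP=> lti.
move: leV; rewrite leqNgt -(sum_card_allocation B V allocB) => /negP[].
rewrite -[n in ltnRHS]card_ord -sum_nat_const (bigD1 i) // [ltnRHS](bigD1 i) //=.
by rewrite -addSn leq_add // leq_sum // => j _; apply: leq_trans (near i j) _.
Qed.

Local Open Scope ring_scope.

(** * EF1 in terms of counts *)

Section EnvyFreeness.
Context {R : realType} {n : nat} {I : instance R n} {V : {set goods I}}.

Lemma binary_utilE (i0 : 'I_n) :
    identical_utilities I -> binary_utilities I ->
    V = [set g | util I i0 [set g] == 1] ->
  forall i S, util I i S = #|S :&: V|%:R.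
Proof.
move=> idI binI -> i S.
rewrite (idI i i0) util_additive -sum1_card natr_sum.
rewrite [LHS]big_mkcond [RHS]big_mkcond /=.
apply: eq_bigr => g _; rewrite !inE; case: (g \in S) => //=.
by case: (binI i0 g) => ->; rewrite ?eqxx // eq_sym oner_eq0.
Qed.

Hypothesis utilE : forall i S, util I i S = #|S :&: V|%:R.

Lemma EF1_towardsE (A : {ffun 'I_n -> {set goods I}}) i j :
  EF1_towards A i j = (#|A j :&: V| <= #|A i :&: V|.+1)%N.
Proof.
have cardD1 g : g \in A j -> #|A j :&: V| = ((g \in V) + #|(A j :\ g) :&: V|)%N.
  by move=> Ajg; rewrite (cardsD1 g (A j :&: V)) inE Ajg setIDAC.
apply/orP/idP => [[/eqP->|/existsP[g /andP[Ajg]]]|le_ji].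
- by rewrite set0I cards0.
- rewrite !utilE ler_nat (cardD1 g Ajg) => le_ji.
  by rewrite -add1n leq_add // leq_b1.
(* The best good to remove is one in [V]; if [A j] has none, any good will do. *)
have [/eqP Aj0|[g Ajg Vg]] : A j == set0 \/
    exists2 g, g \in A j & (g \in V) || (#|A j :&: V| == 0)%N.
- have [->|[g Ajg]] := set_0Vmem (A j); first by left.
  have [AjV0|[h AVh]] := set_0Vmem (A j :&: V); right.
    by exists g; rewrite // AjV0 cards0 orbT.
  by move: AVh; rewrite inE => /andP[Ajh Vh]; exists h; rewrite ?Vh.
- by left; apply/eqP.
right; apply/existsP; exists g; rewrite Ajg !utilE ler_nat /=.
by move: le_ji Vg; rewrite (cardD1 g Ajg); case: (g \in V) => //= _; lia.
Qed.

Lemma EF1P (A : {ffun 'I_n -> {set goods I}}) :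
  reflect (forall i j, (#|A j :&: V| <= #|A i :&: V|.+1)%N) (EF1 A).
Proof.
apply: (iffP forallP) => near i; last first.
  by apply/forallP=> j; apply/implyP=> _; rewrite EF1_towardsE.
move=> j; have [->|nij] := eqVneq i j; first exact: leqnSn.
by move/forallP: (near i) => /(_ j); rewrite nij EF1_towardsE.
Qed.

End EnvyFreeness.

(** * The upper bound *)

Lemma exchanges_suffice_upper (R : realType) n s : (0 < n)%N ->
  exchanges_suffice R n s (uphalf n * n./2 * s %/ n).
Proof.
move=> n_gt0 I idI binI _ A allocA balA.
pose V := [set g | util I (Ordinal n_gt0) [set g] == 1].
have utilE := binary_utilE (Ordinal n_gt0) idI binI (erefl V).
have les i : (#|A i :&: V| <= s)%N.
  by move/forallP: balA => /(_ i)/eqP<-; rewrite subset_leq_card ?subsetIl.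
have [t [sumt tles neart bound]] := balanced_target n s _ n_gt0 les.
rewrite (sum_card_allocation A V allocA) in sumt.
have [|B [allocB reachB ctB]] := reach_target A V s t
    (uphalf n * n./2 * s %/ n) allocA balA tles sumt.
  by rewrite leq_divRL // mulnC; apply: bound.
exists B; split=> //.
by apply/(EF1P utilE) => i j; rewrite !ctB.
Qed.

(** * The extremal instance and the lower bound *)

Section ExtremalInstance.
Context (R : realType) {n : nat} (s : nat) (V : {set 'I_n * 'I_s}).

(** Goods are pairs so that the first component can name the initial owner. *)
Definition count_util (i : 'I_n) (S : {set 'I_n * 'I_s}) : R := #|S :&: V|%:R.

Lemma count_util_ge0 i S : 0 <= count_util i S.
Proof. exact: ler0n. Qed.

Lemma count_util_additive i S :
  count_util i S = \sum_(g in S) count_util i [set g].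
Proof.
rewrite /count_util -natr_sum; congr _%:R.
rewrite -sum1_card [LHS]big_mkcond [RHS]big_mkcond /=.
apply: eq_bigr => g _; rewrite !inE.
case: (g \in S) => //=; case: ifP => [Vg|nVg].
  by rewrite (setIidPl _) ?cards1 // sub1set.
by apply/esym/eqP; rewrite cards_eq0 setI_eq0 disjoints1 nVg.
Qed.

Definition count_instance : instance R n :=
  Instance count_util_ge0 count_util_additive.

End ExtremalInstance.

Lemma exchanges_suffice_lower (R : realType) n s k (P : {set 'I_n}) :
  exchanges_suffice R n s k -> (#|P| * ((n - #|P|) * s %/ n) <= k)%N.
Proof.
(* The valuable goods are those that [A] below gives to agents outside [P]. *)
pose V : {set 'I_n * 'I_s} := setX (~: P) setT.
pose I := count_instance R s V.
pose A : {ffun 'I_n -> {set goods I}} := [ffun i => [set x | x.1 == i]].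
have cardX1 (S : {set 'I_s}) (i : 'I_n) : #|setX [set i] S| = #|S|.
  by rewrite cardsX cards1 mul1n.
have idI : identical_utilities I by [].
have binI : binary_utilities I.
  move=> i g /=; rewrite /count_util; have := subset_leq_card (subsetIl [set g] V).
  by rewrite cards1; case: #|_| => [|[|//]] _; [left|right].
have cardI : #|goods I| = (n * s)%N by rewrite card_prod !card_ord.
have allocA : allocation A.
  apply/allocationP; split=> [i j x|x]; last by exists x.1; rewrite ffunE inE.
  by rewrite !ffunE !inE => /eqP-> /eqP.
have balA : balanced s A.
  apply/forallP=> i; rewrite ffunE -[X in _ == X](card_ord s) -cardsT -(cardX1 _ i).
  by apply/eqP; congr #|pred_of_set _|; apply/setP=> x; rewrite !inE andbT.
move=> /(_ I idI binI cardI A allocA balA)[B [allocB EF1B reachB]].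
have := reachable_bigcup A B V P k reachB.
rewrite -(sum_card_bundles B V P allocB) (_ : _ :&: V = set0); last first.
  apply/setP=> x; rewrite !inE andbT; apply/negbTE/negP=> /andP[/bigcupP[i Pi]].
  by rewrite ffunE inE => /eqP->; rewrite Pi.
rewrite cards0 add0n; apply: leq_trans; rewrite -sum_nat_const; apply: leq_sum => i _.
have nearB : forall i j, (#|B j :&: V| <= #|B i :&: V|.+1)%N by apply/EF1P: EF1B.
apply: EF1_floor allocB nearB _ i.
rewrite cardsX cardsT card_ord mulnC.
have <- : (#|~: P| = n - #|P|)%N by have := cardsC P; rewrite card_ord; lia.
exact: leq_trunc_div.
Qed.

(** * The least number of exchanges and the final arithmetic *)

Lemma exchanges_suffice_min (R : realType) n s k :
  exchanges_suffice R n s k -> exists f, is_f_id_bin R n s f.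
Proof.
(* Minimisation over [nat] needs a boolean predicate, supplied by the classical truth value. *)
move=> suffk; have exk : exists k, `[< exchanges_suffice R n s k >].
  by exists k; apply/asboolP.
case: (ex_minnP exk) => f /asboolP sufff minf; exists f; split=> // l suffl.
by apply: minf; apply/asboolP.
Qed.

Theorem theorem5p3 (R : realType) (n s : nat) (hn : (2 <= n)%N) (hs : (1 <= s)%N) :
  exists f : nat,
    [/\ is_f_id_bin R n s f,
        ~~ odd n ->
          (n %/ 2 * (s %/ 2) <= f)%N
          /\ f%:R <= s%:R * n%:R / 4%:R :> rat
      & odd n ->
          ((n + 1) %/ 2 * ((s * (n - 1)) %/ (2 * n)) <= f)%N
          /\ f%:R <= s%:R * (n%:R - 1) * (n%:R + 1) / (4%:R * n%:R) :> rat].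
Proof.
have n_gt0 : (0 < n)%N by lia.
have suff_up := exchanges_suffice_upper R n s n_gt0.
have [f min_f] := exchanges_suffice_min R n s _ suff_up.
have [sufff leastf] := min_f.
have lower : (uphalf n * (n./2 * s %/ n) <= f)%N.
  (* This size of [P] maximises [#|P| * (n - #|P|)], the product in the upper bound. *)
  have [|P [_ _ cardP]] := intermediate_set _ set0 setT (uphalf n) (sub0set [set: 'I_n]).
    by rewrite cards0 cardsT card_ord; lia.
  have := exchanges_suffice_lower R n s f P sufff.
  by rewrite cardP (_ : (n - uphalf n)%N = n./2) //; lia.
have upper : (n * f <= uphalf n * n./2 * s)%N.
  by rewrite mulnC -leq_divRL //; apply: leastf.
have n_neq0 : n%:R != 0 :> rat by rewrite pnatr_eq0 -lt0n.
exists f; split=> // [even_n|odd_n].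
- have Dn : (n = 2 * n./2)%N by lia.
  split.
    apply: leq_trans lower; rewrite leq_mul //; first by lia.
    (* Cancelling [n./2] turns [n./2 * s %/ n] into [s %/ 2]. *)
    by rewrite -(@divnMl n./2 s 2) 1?[(n./2 * 2)%N]mulnC -?Dn //; lia.
  rewrite ler_pdivlMr ?ltr0n // -!natrM ler_nat.
  have Un : uphalf n = n./2 by lia.
  have : (2 * f <= n./2 * s)%N.
    rewrite -(@leq_pmul2l n./2); last by lia.
    by rewrite mulnA [(_ * 2)%N]mulnC -Dn mulnA -{1}Un.
  by move: Dn; set h := n./2 => ->; lia.
- have Dn : (n = 2 * n./2 + 1)%N by lia.
  split.
    apply: leq_trans lower; rewrite leq_mul //; first by lia.
    by rewrite (_ : s * (n - 1) = 2 * (n./2 * s))%N ?divnMl //; nia.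
  rewrite ler_pdivlMr; last by rewrite mulr_gt0 ?ltr0n.
  have -> : n%:R - 1 = (n - 1)%:R :> rat by rewrite natrB.
  have Un : uphalf n = n./2.+1 by lia.
  rewrite natr1 -!natrM ler_nat.
  (* The two factors 2 cancel the 4 in the denominator, which leaves [upper]. *)
  have -> : (n - 1 = 2 * n./2)%N by lia.
  have -> : (n.+1 = 2 * n./2.+1)%N by lia.
  by move: upper; rewrite Un; lia.
Qed.
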